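(* Let $r_0\ge2$ be an integer. Let $(\tilde f_t)$ be a $C^{r_0,r_0}$ perturbation of a piecewise expanding $C^{r_0}$ unimodal map $f$, such that for each small $t$ there exists a homeomorphism $h_t$ of $I$ with $h_t(c)=c$ and $\tilde f_t=h_t\circ f\circ h_t^{-1}$. Let $v=\partial_t\tilde f_t|_{t=0}$. Then the bounded function $\alpha:I\to\mathbb R$ defined by $\alpha(x)=\partial_th_t(x)|_{t=0}$ satisfies $$v(x)=\alpha(f(x))-f'(x)\alpha(x),\qquad\forall x\in I,\ x\ne c .$$ In addition, $\alpha$ is continuous, $\alpha(c)=0$ and $v(c)-\alpha(c_1)=0$, so that $v$ is horizontal for $f$.
   Context: Fix $I=[a,b]$, $a<c<b$, $I_+=[a,c]$, $I_-=[c,b]$. For $r\ge1$, a piecewise expanding $C^r$ unimodal map is a continuous $f:I\to I$, strictly increasing on $I_+$, strictly decreasing on $I_-$, with $f(a)=f(b)=a$, such that for $\sigma=\pm$ the map $f|_{I_\sigma}$ extends to a $C^r$ map on a neighbourhood of $I_\sigma$ and $\inf|f'|_{I_\sigma}|>1$. Put $c_k=f^k(c)$. For integers $r\ge r_0\ge2$, a $C^{r_0,r}$ perturbation of such an $f$ is a family of piecewise expanding $C^r$ unimodal maps $f_t:I\to I$, $|t|<\epsilon$ (same $a,c,b$), with $f_0=f$, such that: for $\sigma=\pm$ there is a neighbourhood $\mathcal I_\sigma$ of $I_\sigma$ on which the extensions of $f_t|_{I_\sigma}$ have $C^r$ norm uniformly bounded for small $|t|$ and satisfy $\|(f-f_t)|_{\mathcal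 I_\sigma}\|_{C^{r-1}}=O(t)$; and $(x,t)\mapsto f_t(x)$, on each of $x\in I_+$, $x\in I_-$, extends to a $C^{r_0}$ function on a neighbourhood of $I_\sigma\times\{0\}$. It is known that under these assumptions $t\mapsto h_t(x)$ is differentiable near $0$, with derivative bounded uniformly in $x$, so $\alpha$ is well defined and bounded. A continuous $v:I\to\mathbb R$ is horizontal for $f$ if $\sum_{j=0}^{M_f-1}\frac{v(c_j)}{(f^j)'(c_1)}=0$, where $M_f=n_1$ if $c$ is periodic of minimal period $n_1$, and $M_f=+\infty$ otherwise; here $(f^j)'(c_1)=\prod_{i=1}^{j}f'(c_i)$. *)

(* Defs.v *)
From Stdlib Require Import Reals.
From Coquelicot Require Import Coquelicot.
Open Scope R_scope.

(* Maps of I = [a, b] are functions R -> R; every notion below depends only on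
   their values on I. *)

Definition Icc (l u : R) : R -> Prop := fun x => l <= x <= u.

(* Derivative relative to D: one-sided at an endpoint of an interval D. *)
Definition is_derive_on (D : R -> Prop) (f : R -> R) (x l : R) : Prop :=
  filterlim (fun y => (f y - f x) / (y - x))
    (within D (locally' x)) (locally l).

Definition derive_on (D : R -> Prop) (f : R -> R) (x : R) : R :=
  iota (is_derive_on D f x).

Definition C_on (r : nat) (U : R -> Prop) (g : R -> R) : Prop :=
  forall k x, (k <= r)%nat -> U x ->
    ex_derive_n g k x /\ continuous (Derive_n g k) x.

(* The C^r norm of g on U is at most K. *)
Definition C_norm_le (r : nat) (U : R -> Prop) (g : R -> R) (K : R) : Prop :=
  forall k x, (k <= r)%nat -> U x -> Rabs (Derive_n g k x) <= K.

Definition expanding_branch (r : nat) (J : R -> Prop) (f : R -> R) : Prop :=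
  exists (U : R -> Prop) (g : R -> R) (lambda : R),
    open U /\ (forall x, J x -> U x) /\
    (forall x, J x -> g x = f x) /\ C_on r U g /\
    1 < lambda /\ (forall x, J x -> lambda <= Rabs (Derive g x)).

Record unimodal (r : nat) (a c b : R) (f : R -> R) : Prop := {
  unimodal_maps : forall x, Icc a b x -> Icc a b (f x);
  unimodal_cont : continuous_on (Icc a b) f;
  unimodal_incr : forall x y, a <= x -> x < y -> y <= c -> f x < f y;
  unimodal_decr : forall x y, c <= x -> x < y -> y <= b -> f y < f x;
  unimodal_left : f a = a;
  unimodal_right : f b = a;
  unimodal_plus : expanding_branch r (Icc a c) f;
  unimodal_minus : expanding_branch r (Icc c b) f
}.

(* On the branch J, the maps [ft t] have extensions [F t] to a common
   neighbourhood U of J, for small t; F 0 is the extension of f. *)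
Definition bounded_branch_family
    (r : nat) (J : R -> Prop) (ft : R -> R -> R) : Prop :=
  exists (U : R -> Prop) (F : R -> R -> R) (K : R),
    open U /\ (forall x, J x -> U x) /\
    locally 0 (fun t =>
      (forall x, J x -> F t x = ft t x) /\
      C_on r U (F t) /\ C_norm_le r U (F t) K /\
      C_norm_le (pred r) U (fun x => F 0 x - F t x) (K * Rabs t)).

(* [ex_diff_n G r0] at all points of the open set W means that all partial
   derivatives of G up to order r0 exist and are continuous on W. *)
Definition smooth_branch_family
    (r0 : nat) (eps : R) (J : R -> Prop) (ft : R -> R -> R) : Prop :=
  exists (W : R * R -> Prop) (G : R -> R -> R),
    open W /\ (forall x, J x -> W (x, 0)) /\
    (forall x t, W (x, t) -> J x -> Rabs t < eps -> G x t = ft t x) /\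
    (forall x t, W (x, t) -> ex_diff_n G r0 x t).

Record perturbation (r0 r : nat) (a c b eps : R)
    (f : R -> R) (ft : R -> R -> R) : Prop := {
  perturbation_eps : 0 < eps;
  perturbation_unimodal :
    forall t, Rabs t < eps -> unimodal r a c b (ft t);
  perturbation_zero : forall x, Icc a b x -> ft 0 x = f x;
  perturbation_bounded_plus : bounded_branch_family r (Icc a c) ft;
  perturbation_bounded_minus : bounded_branch_family r (Icc c b) ft;
  perturbation_smooth_plus : smooth_branch_family r0 eps (Icc a c) ft;
  perturbation_smooth_minus : smooth_branch_family r0 eps (Icc c b) ft
}.

(* h and k are mutually inverse homeomorphisms of D. *)
Definition homeo_on (D : R -> Prop) (h k : R -> R) : Prop :=
  (forall x, D x -> D (h x)) /\ (forall x, D x -> D (k x)) /\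
  (forall x, D x -> k (h x) = x) /\ (forall x, D x -> h (k x) = x) /\
  continuous_on D h /\ continuous_on D k.

(* h is a homeomorphism of I fixing c with g = h o f o h^-1 on I. *)
Definition conjugates (a c b : R) (h f g : R -> R) : Prop :=
  exists k : R -> R,
    homeo_on (Icc a b) h k /\ h c = c /\
    (forall x, Icc a b x -> g x = h (f (k x))).

(* c_j = f^j(c) *)
Definition orbit (f : R -> R) (c : R) (j : nat) : R := Nat.iter j f c.

(* (f^j)'(c_1) = f'(c_1) * ... * f'(c_j) *)
Fixpoint orbit_deriv (a c b : R) (f : R -> R) (j : nat) : R :=
  match j with
  | O => 1
  | S i => orbit_deriv a c b f i * derive_on (Icc a b) f (orbit f c (S i))
  end.

Definition minimal_period (f : R -> R) (c : R) (n : nat) : Prop :=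
  (0 < n)%nat /\ orbit f c n = c /\
  (forall m, (0 < m < n)%nat -> orbit f c m <> c).

Definition horizontal (a c b : R) (f v : R -> R) : Prop :=
  let term j := v (orbit f c j) / orbit_deriv a c b f j in
  continuous_on (Icc a b) v /\
  (forall n, minimal_period f c n -> sum_n term (pred n) = 0) /\
  ((forall n, (0 < n)%nat -> orbit f c n <> c) -> is_series term 0).

(* Main.v *)
Require Import Defs.
From Stdlib Require Import Reals Lra Lia Classical.
From Coquelicot Require Import Coquelicot.
Open Scope R_scope.

(* h_t preserves each branch interval, so h_t(x) and x always lie on a common
   branch, where f expands by lam > 1. An error measured at f(x) therefore
   controls lam times the error at x, and any bounded error contracts to its
   source term. This is applied three times: to |h_t(x) - x|, which gives
   h_t = id + O(t) uniformly; to the oscillation as t -> 0 of the difference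
   quotients (h_t(x) - x)/t, which satisfy the twisted cohomological equation
   up to o(1) and hence converge; and to the oscillation of alpha near x, which
   gives continuity. At x = c the equation holds with either one-sided slope,
   because alpha(c) = 0. Horizontality follows by telescoping along the orbit
   of c. *)

(** * Epsilon forms of continuity and differentiability; mean and intermediate values on
    intervals *)

Lemma continuous_on_eps (D : R -> Prop) (f : R -> R) :
  continuous_on D f <->
  (forall x, D x -> forall e, 0 < e ->
     locally x (fun y => D y -> Rabs (f y - f x) < e)).
Proof.
  split.
  - intros H x Dx e He.
    exact (proj1 (filterlim_locally _ _) (H x Dx) (mkposreal e He)).
  - intros H x Dx. apply filterlim_locally. intros e.
    exact (H x Dx e (cond_pos e)).
Qed.

Lemma is_derive_littleo (u : R -> R) (x l : R) :
  is_derive u x l <->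
  (forall e, 0 < e ->
     locally x (fun y => Rabs (u y - u x - l * (y - x)) <= e * Rabs (y - x))).
Proof.
  split.
  - intros [_ H] e He.
    specialize (H x (fun P HP => HP) (mkposreal e He)).
    revert H. apply filter_imp. intros y Hy.
    replace (l * (y - x)) with ((y - x) * l) by ring. exact Hy.
  - intros H. split. apply is_linear_scal_l.
    (* Differentiability is phrased at every limit [z] of the filter [locally x]; limits being
       unique, [z] can only be [x]. *)
    intros z Hz e. apply (@is_filter_lim_locally_unique R_AbsRing R_NormedModule) in Hz. subst z.
    generalize (H e (cond_pos e)). apply filter_imp. intros y Hy.
    replace (l * (y - x)) with ((y - x) * l) in Hy by ring. exact Hy.
Qed.

Lemma mvt_Icc (g : R -> R) (l u : R) :
  (forall x, Icc l u x -> ex_derive g x) ->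
  forall x y, Icc l u x -> Icc l u y ->
  exists z, Icc l u z /\ g y - g x = Derive g z * (y - x).
Proof.
  unfold Icc. intros Hg x y Hx Hy.
  assert (Hm : forall z, Rmin x y <= z <= Rmax x y -> l <= z <= u).
  { intros z. unfold Rmin, Rmax. destruct (Rle_dec x y); lra. }
  destruct (MVT_gen g x y (Derive g)) as [z [Hz E]].
  - intros z Hz. apply Derive_correct, Hg, Hm. lra.
  - intros z Hz. apply continuity_pt_filterlim.
    apply (ex_derive_continuous g z), Hg, Hm, Hz.
  - exists z. split; auto.
Qed.

Lemma IVT_Icc (k : R -> R) (l u y : R) :
  l <= u -> continuous_on (Icc l u) k ->
  Rmin (k l) (k u) <= y <= Rmax (k l) (k u) ->
  exists x, Icc l u x /\ k x = y.
Proof.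
  intros Hlu Hk Hy.
  (* [p] is the retraction onto [[l, u]]. It is 1-Lipschitz, so [k] composed with [p] is continuous
     on the whole line and the intermediate value theorem applies to it. *)
  pose (p := fun x => Rmax l (Rmin u x)).
  assert (Hp : forall x, Icc l u (p x)).
  { intros x. unfold Icc, p, Rmax, Rmin.
    destruct (Rle_dec u x); destruct Rle_dec; lra. }
  assert (Hid : forall x, Icc l u x -> p x = x).
  { unfold Icc, p. intros x Hx. rewrite Rmin_right by lra. apply Rmax_right. lra. }
  assert (Hlip : forall x z, Rabs (p x - p z) <= Rabs (x - z)).
  { intros x z. unfold p, Rmax, Rmin.
    repeat destruct Rle_dec; unfold Rabs; repeat destruct Rcase_abs; lra. }
  destruct (IVT_gen (fun x => k (p x)) l u y) as [x [_ Hx]].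
  - intros x. apply continuity_pt_filterlim, filterlim_locally. intros e.
    destruct (proj1 (continuous_on_eps _ _) Hk (p x) (Hp x) e (cond_pos e)) as [d Hd].
    exists d. intros z Hz. apply Hd; auto.
    apply Rle_lt_trans with (2 := Hz). apply Hlip.
  - rewrite !Hid; unfold Icc; lra.
  - exists (p x). auto.
Qed.

Lemma continuous_on_subset (D E : R -> Prop) (f : R -> R) :
  (forall x, E x -> D x) -> continuous_on D f -> continuous_on E f.
Proof.
  intros HED H. apply continuous_on_eps. intros x Ex e He.
  generalize (proj1 (continuous_on_eps _ _) H x (HED x Ex) e He).
  apply filter_imp. auto.
Qed.

(** * Homeomorphisms of an interval and invariance of the branches under conjugacy *)

(** A level strictly above [k p] but at most both endpoint values would be attained on each side of
    [p], against injectivity. *)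
Lemma injective_no_interior_min (a b p : R) (k : R -> R) :
  continuous_on (Icc a b) k ->
  (forall x y, Icc a b x -> Icc a b y -> k x = k y -> x = y) ->
  a < p < b -> (forall x, Icc a b x -> k p <= k x) -> False.
Proof.
  intros Hk Hinj Hp Hmin.
  assert (Ia : Icc a b a) by (unfold Icc; lra).
  assert (Ib : Icc a b b) by (unfold Icc; lra).
  assert (Ip : Icc a b p) by (unfold Icc; lra).
  assert (Ha : k p <> k a) by (intros E; apply Hinj in E; auto; lra).
  assert (Hb : k p <> k b) by (intros E; apply Hinj in E; auto; lra).
  pose proof (Hmin a Ia). pose proof (Hmin b Ib).
  set (m := Rmin (k a) (k b)).
  assert (Hm : k p < m /\ m <= k a /\ m <= k b).
  { unfold m, Rmin. destruct Rle_dec; lra. }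
  destruct (IVT_Icc k a p m) as [x [Hx Ex]].
  - lra.
  - apply continuous_on_subset with (2 := Hk). unfold Icc. intros; lra.
  - rewrite Rmin_right, Rmax_left; lra.
  - destruct (IVT_Icc k p b m) as [y [Hy Ey]].
    + lra.
    + apply continuous_on_subset with (2 := Hk). unfold Icc. intros; lra.
    + rewrite Rmin_left, Rmax_right; lra.
    + unfold Icc in Hx, Hy.
      assert (x = y) by (apply Hinj; unfold Icc; lra).
      assert (Exp : x = p) by lra. rewrite Exp in Ex. lra.
Qed.

(** If [k p] were an endpoint of the interval, [p] would be an interior minimum of the injective
    function [k] or of its negative. *)
Lemma homeo_interior (a b p : R) (h k : R -> R) :
  homeo_on (Icc a b) h k -> a < p < b -> a < k p < b.
Proof.
  intros (Hh & Hk & _ & Hhk & _ & Ck) Hp.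
  assert (Hinj : forall x y, Icc a b x -> Icc a b y -> k x = k y -> x = y).
  { intros x y Hx Hy E. rewrite <- (Hhk x Hx), <- (Hhk y Hy), E. reflexivity. }
  assert (Ip : Icc a b p) by (unfold Icc; lra).
  destruct (Hk p Ip) as [[H1 | H1] [H2 | H2]]; try (split; assumption); exfalso.
  2, 3: apply (injective_no_interior_min a b p k Ck Hinj Hp);
    intros x Hx; apply Hk in Hx; unfold Icc in Hx; lra.
  - apply (injective_no_interior_min a b p (fun x => - k x)); auto.
    + apply continuous_on_eps. intros x Hx e He.
      generalize (proj1 (continuous_on_eps _ _) Ck x Hx e He).
      apply filter_imp. intros y H Hy. replace (- k y - - k x) with (- (k y - k x)) by ring.
      rewrite Rabs_Ropp. auto.
    + intros x y Hx Hy E. apply Hinj; auto; lra.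
    + intros x Hx. apply Hk in Hx. unfold Icc in Hx. lra.
Qed.

(** [h] fixes [a], [c] and [b]; being injective, it takes the value [c] only at [c], so by
    intermediate values it cannot carry a point across [c]. *)
Lemma conjugates_branches (r : nat) (a c b : R) (h f g : R -> R) :
  a < c -> c < b -> unimodal r a c b f -> unimodal r a c b g ->
  conjugates a c b h f g ->
  (forall x, Icc a b x -> h (f x) = g (h x)) /\
  (forall x, Icc a c x -> Icc a c (h x)) /\
  (forall x, Icc c b x -> Icc c b (h x)).
Proof.
  intros hac hcb Uf Ug [k [Hhk [hc Hg]]].
  destruct (Hhk) as (Hh & Hk & Hkh & Hh' & Ch & Ck).
  assert (Hcomm : forall x, Icc a b x -> h (f x) = g (h x)).
  { intros x Hx. rewrite Hg, Hkh; auto. }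
  assert (Hinj : forall x y, Icc a b x -> Icc a b y -> h x = h y -> x = y).
  { intros x y Hx Hy E. rewrite <- (Hkh x Hx), <- (Hkh y Hy), E. reflexivity. }
  assert (Ia : Icc a b a) by (unfold Icc; lra).
  assert (Ib : Icc a b b) by (unfold Icc; lra).
  (* If [h x] were interior, then so would be [k (h x) = x]. *)
  assert (Hend : forall x, Icc a b x -> x = a \/ x = b -> h x = a \/ h x = b).
  { intros x Hx E. destruct (Hh x Hx) as [[H1 | H1] [H2 | H2]]; auto.
    assert (Hi : a < k (h x) < b) by (apply (homeo_interior a b (h x) h k); auto).
    rewrite Hkh in Hi; auto. lra. }
  (* Dynamics excludes an orientation reversal: if [h a = b], then [f a = a] would give
     [b = h a = g (h a) = g b = a]. *)
  assert (ha : h a = a).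
  { destruct (Hend a Ia (or_introl eq_refl)) as [E | E]; auto.
    pose proof (Hcomm a Ia) as H. rewrite (unimodal_left _ _ _ _ _ Uf), E in H.
    rewrite (unimodal_right _ _ _ _ _ Ug) in H. lra. }
  assert (hb : h b = b).
  { destruct (Hend b Ib (or_intror eq_refl)) as [E | E]; auto.
    assert (a = b) by (apply Hinj; auto; lra). lra. }
  split; [exact Hcomm |]. split; intros x Hx; unfold Icc in Hx.
  - assert (Ix : Icc a b x) by (unfold Icc; lra).
    destruct (Hh x Ix) as [H1 H2]. split; auto.
    destruct (Rle_lt_dec (h x) c) as [| Hlt]; auto. exfalso.
    destruct (IVT_Icc h a x c) as [z [Hz Ez]].
    + lra.
    + apply continuous_on_subset with (2 := Ch). unfold Icc. intros; lra.
    + rewrite ha, Rmin_left, Rmax_right; lra.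
    + unfold Icc in Hz. assert (z = c) by (apply Hinj; unfold Icc; lra).
      assert (Exc : x = c) by lra. rewrite Exc in Hlt. lra.
  - assert (Ix : Icc a b x) by (unfold Icc; lra).
    destruct (Hh x Ix) as [H1 H2]. split; auto.
    destruct (Rle_lt_dec c (h x)) as [| Hlt]; auto. exfalso.
    destruct (IVT_Icc h x b c) as [z [Hz Ez]].
    + lra.
    + apply continuous_on_subset with (2 := Ch). unfold Icc. intros; lra.
    + rewrite hb, Rmin_left, Rmax_right; lra.
    + unfold Icc in Hz. assert (z = c) by (apply Hinj; unfold Icc; lra).
      assert (Exc : x = c) by lra. rewrite Exc in Hlt. lra.
Qed.

(** * The contraction principle behind all three limit arguments *)

(* One step of an expanding map divides an error bound by [lam], up to an
   arbitrarily small loss. *)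
Lemma contraction_small (P : R -> Prop) (lam B0 : R) :
  1 < lam -> 0 <= B0 -> P B0 ->
  (forall B e, 0 <= B -> 0 < e -> P B -> P (B / lam + e)) ->
  forall e, 0 < e -> exists B, 0 <= B < e /\ P B.
Proof.
  intros Hlam HB0 H0 Hstep e He.
  (* With this loss [s], the map sending [B] to [B / lam + s] has fixed point [e / 2], so its
     iterates from [B0] interpolate geometrically between [B0] and [e / 2]. *)
  pose (s := e / 2 * (1 - / lam)).
  assert (Hinv : 0 < / lam < 1).
  { split. apply Rinv_0_lt_compat; lra. rewrite <- Rinv_1. apply Rinv_lt_contravar; lra. }
  assert (Hs : 0 < s) by (unfold s; apply Rmult_lt_0_compat; lra).
  assert (Hn : forall n, P (B0 * (/ lam) ^ n + e / 2 * (1 - (/ lam) ^ n))).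
  { induction n as [| n IH].
    - simpl. replace (B0 * 1 + e / 2 * (1 - 1)) with B0 by ring. exact H0.
    - apply Hstep with (e := s) in IH; auto.
      + replace (B0 * (/ lam) ^ S n + e / 2 * (1 - (/ lam) ^ S n)) with
          ((B0 * (/ lam) ^ n + e / 2 * (1 - (/ lam) ^ n)) / lam + s); auto.
        unfold s, Rdiv. simpl. ring.
      + assert (0 < (/ lam) ^ n) by (apply pow_lt; lra).
        assert ((/ lam) ^ n <= 1).
        { rewrite <- (pow1 n). apply pow_incr. lra. }
        apply Rplus_le_le_0_compat; apply Rmult_le_pos; lra. }
  (* Dividing by [B0 + 1] rather than [B0] also covers [B0 = 0]. *)
  destruct (pow_lt_1_zero (/ lam)) with (y := e / 2 / (B0 + 1)) as [N HN].
  - rewrite Rabs_pos_eq; lra.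
  - apply Rdiv_lt_0_compat; lra.
  - specialize (HN N (Nat.le_refl N)).
    assert (Hq : 0 < (/ lam) ^ N) by (apply pow_lt; lra).
    assert (Hq1 : (/ lam) ^ N <= 1).
    { rewrite <- (pow1 N). apply pow_incr. lra. }
    rewrite Rabs_pos_eq in HN by lra.
    exists (B0 * (/ lam) ^ N + e / 2 * (1 - (/ lam) ^ N)). split; [| apply Hn].
    assert ((B0 + 1) * (/ lam) ^ N < e / 2).
    { apply Rmult_lt_reg_l with (/ (B0 + 1)). apply Rinv_0_lt_compat; lra.
      rewrite <- Rmult_assoc, Rinv_l by lra. unfold Rdiv in HN |- *. lra. }
    split.
    + apply Rplus_le_le_0_compat; apply Rmult_le_pos; lra.
    + assert (0 < e / 2 * (/ lam) ^ N) by (apply Rmult_lt_0_compat; lra). lra.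
Qed.

(** * Perturbation estimates on a single branch *)

(** The quantitative content of the hypotheses on one closed branch. [D] is the slope of the branch,
    one-sided at its ends, and thus depends on the branch, whereas [v] is the common speed in [t].
    [branch_C1] expresses closeness of derivatives by finite differences. *)
Record branch (J : R -> Prop) (f : R -> R) (ft : R -> R -> R)
    (v D : R -> R) (lam K : R) : Prop := {
  branch_slope : forall x, J x -> lam <= Rabs (D x);
  branch_slope_cont : continuous_on J D;
  branch_expand : forall x y, J x -> J y -> lam * Rabs (y - x) <= Rabs (f y - f x);
  branch_deriv : forall x, J x -> forall e, 0 < e ->
    locally x (fun y => J y -> Rabs (f y - f x - D x * (y - x)) <= e * Rabs (y - x));
  branch_C0 : locally 0 (fun t => forall x, J x -> Rabs (ft t x - f x) <= K * Rabs t);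
  branch_C1 : locally 0 (fun t => forall x y, J x -> J y ->
    Rabs (ft t y - f y - (ft t x - f x)) <= K * Rabs t * Rabs (y - x));
  branch_speed : forall x, J x -> is_derive (fun t => ft t x) 0 (v x);
  branch_speed_cont : continuous_on J v
}.

Lemma branch_weaken (J : R -> Prop) (f : R -> R) (ft : R -> R -> R)
    (v D : R -> R) (lam lam' K K' : R) :
  lam' <= lam -> K <= K' -> branch J f ft v D lam K -> branch J f ft v D lam' K'.
Proof.
  intros Hl HK [H1 H2 H3 H4 H5 H6 H7 H8]. constructor; auto.
  - intros x Hx. specialize (H1 x Hx). lra.
  - intros x y Hx Hy. apply Rle_trans with (2 := H3 x y Hx Hy).
    apply Rmult_le_compat_r; auto using Rabs_pos.
  - revert H5. apply filter_imp. intros t H x Hx.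
    apply Rle_trans with (1 := H x Hx).
    apply Rmult_le_compat_r; auto using Rabs_pos.
  - revert H6. apply filter_imp. intros t H x y Hx Hy.
    apply Rle_trans with (1 := H x y Hx Hy).
    repeat (apply Rmult_le_compat_r; auto using Rabs_pos).
Qed.

(** For [x] on the branch, [ft t x] coincides near [t = 0] with the jointly smooth [G x t], whose
    partial derivative in [t] exists and is continuous. *)
Lemma smooth_branch_speed (r0 : nat) (eps : R) (J : R -> Prop) (ft : R -> R -> R) :
  (1 <= r0)%nat -> 0 < eps -> smooth_branch_family r0 eps J ft ->
  (forall x, J x -> ex_derive (fun t => ft t x) 0) /\
  continuous_on J (fun x => Derive (fun t => ft t x) 0).
Proof.
  intros Hr He (W & G & HW & HJW & HG & HGr).
  assert (Hext : forall x, J x -> locally 0 (fun t => G x t = ft t x)).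
  { intros x Hx. destruct (HW (x, 0) (HJW x Hx)) as [d Hd].
    assert (Hm : 0 < Rmin d eps) by (apply Rmin_glb_lt; auto using cond_pos).
    exists (mkposreal _ Hm). intros t Ht.
    change (Rabs (t - 0) < Rmin d eps) in Ht.
    apply HG; auto.
    - apply Hd. split; [apply ball_center |].
      apply Rlt_le_trans with (1 := Ht), Rmin_l.
    - rewrite Rminus_0_r in Ht. apply Rlt_le_trans with (1 := Ht), Rmin_r. }
  destruct r0 as [| m]; [lia |].
  split.
  - intros x Hx. apply ex_derive_ext_loc with (1 := Hext x Hx).
    apply (HGr x 0 (HJW x Hx)).
  - apply continuous_on_eps. intros x Hx e Hpe.
    destruct (HGr x 0 (HJW x Hx)) as (_ & _ & _ & H).
    assert (Hc : continuity_2d_pt (fun u v => Derive (G u) v) x 0)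
      by (destruct m; apply H).
    destruct (Hc (mkposreal e Hpe)) as [d Hd].
    exists d. intros y Hy Jy.
    assert (HD : forall z, J z -> Derive (fun t => ft t z) 0 = Derive (G z) 0)
      by (intros z Jz; symmetry; exact (Derive_ext_loc _ _ _ (Hext z Jz))).
    rewrite !HD by auto.
    apply (Hd y 0 Hy). rewrite Rminus_0_r, Rabs_R0. apply cond_pos.
Qed.

(** The slope is the derivative of the smooth extension [g]. Expansion and [branch_C1] follow from
    the mean value theorem applied to [g] and to [F 0 - F t]. *)
Lemma branch_intro (r r0 : nat) (l u eps : R) (f : R -> R) (ft : R -> R -> R) :
  (2 <= r)%nat -> (1 <= r0)%nat -> l < u -> 0 < eps ->
  (forall x, Icc l u x -> ft 0 x = f x) ->
  expanding_branch r (Icc l u) f ->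
  bounded_branch_family r (Icc l u) ft ->
  smooth_branch_family r0 eps (Icc l u) ft ->
  exists D lam K, 1 < lam /\ 0 <= K /\
    branch (Icc l u) f ft (fun x => Derive (fun t => ft t x) 0) D lam K.
Proof.
  intros Hr Hr0 Hlu Heps H0 (U & g & lam & HU & HJU & Hgf & HC & Hlam & Hexp)
    (V & F & K & HV & HJV & HF) Hs.
  assert (Hgd : forall x, Icc l u x -> ex_derive g x).
  { intros x Hx. apply (HC 1%nat x); auto; lia. }
  (* At [t = 0] the extension [F 0] equals [f] on the branch, so [ft t - f] can be read there as
     [F t - F 0]. *)
  destruct (locally_singleton _ _ HF) as (HF0 & HCF0 & _).
  exists (Derive g), lam, (Rmax K 0).
  split; [exact Hlam |]. split; [apply Rmax_r |].
  assert (HK : forall t s, 0 <= s -> K * Rabs t * s <= Rmax K 0 * Rabs t * s).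
  { intros t s Hs0. repeat apply Rmult_le_compat_r; auto using Rabs_pos. apply Rmax_l. }
  constructor.
  - exact Hexp.
  - intros x Hx. apply (filterlim_filter_le_1 (F := locally x)).
    + intros P. unfold within. apply filter_imp. auto.
    + apply (HC 1%nat x); auto; lia.
  - intros x y Hx Hy. rewrite <- !Hgf by auto.
    destruct (mvt_Icc g l u Hgd x y Hx Hy) as [z [Hz ->]].
    rewrite Rabs_mult. apply Rmult_le_compat_r; auto using Rabs_pos.
  - intros x Hx e He.
    generalize (proj1 (is_derive_littleo g x _) (Derive_correct g x (Hgd x Hx)) e He).
    apply filter_imp. intros y H Hy. rewrite <- !Hgf; auto.
  - revert HF. apply filter_imp. intros t (H1 & _ & _ & H2) x Hx.
    rewrite <- H0, <- H1, <- HF0 by auto.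
    rewrite Rabs_minus_sym. apply Rle_trans with (K * Rabs t).
    + exact (H2 0%nat x (Nat.le_0_l _) (HJV x Hx)).
    + specialize (HK t 1). rewrite !Rmult_1_r in HK. apply HK. lra.
  - revert HF. apply filter_imp. intros t (H1 & H3 & _ & H2) x y Hx Hy.
    rewrite <- !H0, <- !H1, <- !HF0 by auto.
    apply Rle_trans with (2 := HK t _ (Rabs_pos (y - x))).
    destruct (mvt_Icc (fun x => F 0 x - F t x) l u) with (x := x) (y := y)
      as [z [Hz E]]; auto.
    + intros z Hz. apply (ex_derive_minus (F 0) (F t)).
      * apply (HCF0 1%nat z); auto; lia.
      * apply (H3 1%nat z); auto; lia.
    + replace (F t y - F 0 y - (F t x - F 0 x))
        with (- (F 0 y - F t y - (F 0 x - F t x))) by ring.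
      rewrite Rabs_Ropp, E, Rabs_mult.
      apply Rmult_le_compat_r; auto using Rabs_pos.
      (* Closeness is given up to order [pred r]; order 1 is available because [2 <= r]. *)
      apply (H2 1%nat z); auto; lia.
  - intros x Hx. apply Derive_correct.
    apply (smooth_branch_speed r0 eps (Icc l u) ft); auto.
  - apply (smooth_branch_speed r0 eps (Icc l u) ft); auto.
Qed.

(** * Conjugacies near [t = 0]: closeness to the identity, linearization, differentiability in
    [t] *)

(** The setting of the estimates: two closed branches covering a bounded [I], possibly overlapping
    as at [c], with common constants, and for small [t] an intertwining [h t] that preserves each
    branch. *)
Record branched_conjugacy (I : R -> Prop) (J : bool -> R -> Prop) (f : R -> R)
    (ft h : R -> R -> R) (v : R -> R) (D : bool -> R -> R) (lam K : R) : Prop := {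
  conj_lam : 1 < lam;
  conj_K : 0 <= K;
  conj_branch : forall s, branch (J s) f ft v (D s) lam K;
  conj_cover : forall x, I x <-> exists s, J s x;
  conj_closed : forall s, closed (J s);
  conj_bounded : exists B, 0 <= B /\ forall x y, I x -> I y -> Rabs (y - x) <= B;
  conj_maps : forall x, I x -> I (f x);
  conj_cont : continuous_on I f;
  conj_eq : locally 0 (fun t =>
    (forall x, I x -> h t (f x) = ft t (h t x)) /\
    (forall s x, J s x -> J s (h t x)))
}.

Section BranchedConjugacy.

Context (I : R -> Prop) (J : bool -> R -> Prop) (f : R -> R)
  (ft h : R -> R -> R) (v : R -> R) (D : bool -> R -> R) (lam K : R)
  (HC : branched_conjugacy I J f ft h v D lam K).

(** A point off a closed branch has a neighbourhood missing it, so only the branches through [x]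
    matter; this glues one-sided statements at [c]. *)
Lemma locally_cover (Q : R -> Prop) (x : R) :
  (forall s, J s x -> locally x (fun y => J s y -> Q y)) ->
  locally x (fun y => I y -> Q y).
Proof.
  intros H. destruct HC as [_ _ _ Hcov Hcl _ _ _ _].
  assert (Hs : forall s, locally x (fun y => J s y -> Q y)).
  { intros s. destruct (classic (J s x)) as [Hx | Hx]; auto.
    apply (open_not _ (Hcl s)) in Hx.
    revert Hx. apply filter_imp. intros y Hn Hy. destruct (Hn Hy). }
  generalize (filter_and _ _ (Hs true) (Hs false)). apply filter_imp.
  intros y [H1 H2] Iy. apply Hcov in Iy. destruct Iy as [[] Hy]; auto.
Qed.

Lemma branch_subset (s : bool) (x : R) : J s x -> I x.
Proof. intros Hx. apply (conj_cover _ _ _ _ _ _ _ _ _ HC). exists s. exact Hx. Qed.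

Lemma conjugacy_near_id :
  exists C, 0 <= C /\
    locally 0 (fun t => forall x, I x -> Rabs (h t x - x) <= C * Rabs t).
Proof.
  pose proof branch_subset as Hsub.
  destruct HC as [Hlam HK Hbr Hcov _ [B0 [HB0 HB]] Hmaps _ Heq].
  (* The constant solves [lam * C = K + C]: the error at [f x] plus the perturbation [K * Rabs t]
     balances [lam] times the error at [x]. *)
  exists (K / (lam - 1)). split.
  { apply Rmult_le_pos; auto. apply Rlt_le, Rinv_0_lt_compat. lra. }
  set (C := K / (lam - 1)).
  assert (EC : lam * C = K + C) by (unfold C; field; lra).
  assert (HC0 : 0 <= C).
  { apply Rmult_le_pos; auto. apply Rlt_le, Rinv_0_lt_compat. lra. }
  generalize (filter_and _ _ Heq (filter_and _ _
    (branch_C0 _ _ _ _ _ _ _ (Hbr true)) (branch_C0 _ _ _ _ _ _ _ (Hbr false)))).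
  apply filter_imp. intros t [[Hht HJ] [H1 H2]].
  assert (H0 : forall s x, J s x -> Rabs (ft t x - f x) <= K * Rabs t)
    by (intros [] x Hx; auto).
  clear H1 H2. pose proof (Rabs_pos t) as Ht.
  assert (HCt : 0 <= C * Rabs t) by (apply Rmult_le_pos; auto).
  (* Here [t] is fixed, and what contracts to zero is the excess over [C * Rabs t], starting from
     the diameter bound [B0]. *)
  assert (Hsmall : forall e, 0 < e -> exists B, 0 <= B < e /\
      forall x, I x -> Rabs (h t x - x) <= B + C * Rabs t).
  { apply contraction_small with (lam := lam) (B0 := B0); auto.
    - intros x Ix. destruct (proj1 (Hcov x) Ix) as [s Hx].
      assert (Rabs (h t x - x) <= B0) by (apply HB; eauto). lra.
    - intros B e HB1 He IH x Ix. destruct (proj1 (Hcov x) Ix) as [s Hx].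
      pose proof (branch_expand _ _ _ _ _ _ _ (Hbr s) x (h t x) Hx (HJ s x Hx)) as He1.
      pose proof (IH (f x) (Hmaps x Ix)) as He2.
      pose proof (H0 s (h t x) (HJ s x Hx)) as He3.
      rewrite Hht in He2 by auto.
      assert (He4 : Rabs (f (h t x) - f x) <= K * Rabs t + (B + C * Rabs t)).
      { replace (f (h t x) - f x)
          with (- (ft t (h t x) - f (h t x)) + (ft t (h t x) - f x)) by ring.
        eapply Rle_trans. apply Rabs_triang. rewrite Rabs_Ropp. lra. }
      apply Rmult_le_reg_l with lam; [lra |].
      apply Rle_trans with (1 := He1). apply Rle_trans with (1 := He4).
      replace (lam * (B / lam + e + C * Rabs t))
        with (B + lam * e + lam * C * Rabs t) by (field; lra).
      rewrite EC. assert (0 < lam * e) by (apply Rmult_lt_0_compat; lra). lra. }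
  intros x Ix. apply le_epsilon. intros e He.
  destruct (Hsmall e He) as [B [HB1 HB2]]. specialize (HB2 x Ix). lra.
Qed.

Lemma conjugacy_at_zero (x : R) : I x -> h 0 x = x.
Proof.
  intros Ix. destruct conjugacy_near_id as [C [_ Hnear]].
  pose proof (locally_singleton _ _ Hnear x Ix) as H.
  rewrite Rabs_R0, Rmult_0_r in H.
  apply Rminus_diag_uniq, Rabs_eq_0, Rle_antisym; auto using Rabs_pos.
Qed.

(** With [y = h t x], the remainder splits into the variation of [ft t - f] between [x] and [y], of
    order [t^2], the Taylor error of [f] at [x], and the error of [ft t x] in [t]. Each gets a third
    of [e]. *)
Lemma conjugacy_linearized (s : bool) (x e : R) :
  J s x -> 0 < e ->
  locally 0 (fun t =>
    Rabs (h t (f x) - f x - D s x * (h t x - x) - v x * t) <= e * Rabs t).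
Proof.
  intros Hx He.
  destruct conjugacy_near_id as [C [HC0 Hnear]].
  pose proof (branch_subset s x Hx) as Ix.
  destruct HC as [Hlam HK Hbr _ _ _ Hmaps _ Heq].
  destruct (Hbr s) as [_ _ _ Hd H0 H1 Hv _].
  assert (E0 : ft 0 x = f x).
  { pose proof (locally_singleton _ _ H0 x Hx) as H.
    rewrite Rabs_R0, Rmult_0_r in H.
    apply Rminus_diag_uniq, Rabs_eq_0, Rle_antisym; auto using Rabs_pos. }
  (* Chosen so that [e1 * (C + 1) * Rabs t] is a third of the budget; [C + 1] is positive even if
     [C = 0]. *)
  pose (e1 := e / 3 / (C + 1)).
  assert (He1 : 0 < e1) by (unfold e1; repeat apply Rdiv_lt_0_compat; lra).
  assert (Hlin : forall q r, 0 <= q -> 0 < r -> locally 0 (fun t => q * Rabs t < r)).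
  { intros q r Hq Hr. assert (Hp : 0 < r / (q + 1)) by (apply Rdiv_lt_0_compat; lra).
    exists (mkposreal _ Hp). intros t Ht. change (Rabs (t - 0) < r / (q + 1)) in Ht.
    rewrite Rminus_0_r in Ht.
    apply Rmult_lt_compat_l with (r := q + 1) in Ht; [| lra].
    replace ((q + 1) * (r / (q + 1))) with r in Ht by (field; lra).
    pose proof (Rabs_pos t). lra. }
  destruct (Hd x Hx e1 He1) as [d Hdd].
  assert (HKC : 0 <= K * C) by (apply Rmult_le_pos; auto).
  assert (He3 : 0 < e / 3) by lra.
  generalize (filter_and _ _ (filter_and _ _ Hnear Heq)
    (filter_and _ _ (filter_and _ _ H1 (proj1 (is_derive_littleo _ _ _) (Hv x Hx) _ He3))
      (filter_and _ _ (Hlin C d HC0 (cond_pos d)) (Hlin (K * C) (e / 3) HKC He3)))).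
  apply filter_imp.
  intros t [[Hn [Hht HJ]] [[Hl Hsp] [Hs1 Hs2]]].
  specialize (Hn x Ix). pose proof (HJ s x Hx) as Hy. rewrite Hht by auto.
  rewrite E0, Rminus_0_r in Hsp.
  set (y := h t x) in *. pose proof (Rabs_pos t) as Ht.
  assert (A1 : Rabs (ft t y - f y - (ft t x - f x)) <= e / 3 * Rabs t).
  { apply Rle_trans with (1 := Hl x y Hx Hy).
    apply Rle_trans with (K * Rabs t * (C * Rabs t)).
    - apply Rmult_le_compat_l; auto. apply Rmult_le_pos; auto.
    - replace (K * Rabs t * (C * Rabs t)) with (K * C * Rabs t * Rabs t) by ring.
      apply Rmult_le_compat_r; lra. }
  assert (A2 : Rabs (f y - f x - D s x * (y - x)) <= e / 3 * Rabs t).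
  { apply Rle_trans with (e1 * Rabs (y - x)).
    - apply Hdd; auto. change (Rabs (y - x) < d). lra.
    - apply Rle_trans with (e1 * ((C + 1) * Rabs t)).
      + apply Rmult_le_compat_l; lra.
      + right. unfold e1. field. lra. }
  replace (ft t y - f x - D s x * (y - x) - v x * t) with
    (ft t y - f y - (ft t x - f x) + (f y - f x - D s x * (y - x)) + (ft t x - f x - v x * t))
    by ring.
  eapply Rle_trans. apply Rabs_triang.
  pose proof (Rabs_triang (ft t y - f y - (ft t x - f x)) (f y - f x - D s x * (y - x))).
  lra.
Qed.

(** The contracted quantity [B] measures non-differentiability: each [x] has some slope [l] with
    [h t x - x = l * t] up to [B * Rabs t], for [t] near 0 depending on [x]. Slope 0 works with
    [B = C]. *)
Lemma conjugacy_ex_derive (x : R) : I x -> ex_derive (fun t => h t x) 0.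
Proof.
  revert x.
  destruct conjugacy_near_id as [C [HC0 Hnear]].
  pose proof conjugacy_at_zero as E0.
  pose proof conjugacy_linearized as Hlin.
  destruct HC as [Hlam HK Hbr Hcov _ _ Hmaps _ _].
  assert (Hsmall : forall e, 0 < e -> exists B, 0 <= B < e /\
    forall x, I x -> exists l,
      locally 0 (fun t => Rabs (h t x - x - l * t) <= B * Rabs t)).
  { apply contraction_small with (lam := lam) (B0 := C); auto.
    - intros x Ix. exists 0. revert Hnear. apply filter_imp. intros t H.
      rewrite Rmult_0_l, Rminus_0_r. auto.
    - intros B e HB He IH x Ix. destruct (proj1 (Hcov x) Ix) as [s Hx].
      destruct (IH (f x) (Hmaps x Ix)) as [l Hl].
      pose proof (branch_slope _ _ _ _ _ _ _ (Hbr s) x Hx) as HD.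
      assert (HD0 : D s x <> 0) by (intros E; rewrite E, Rabs_R0 in HD; lra).
      (* The approximate slope at [f x] is pulled back to [x] by solving the twisted cohomological
         equation. *)
      exists ((l - v x) / D s x).
      generalize (filter_and _ _ Hl (Hlin s x e Hx He)). apply filter_imp.
      intros t [H1 H2]. pose proof (Rabs_pos t) as Ht.
      set (d := h t x - x - (l - v x) / D s x * t).
      assert (Ed : D s x * d =
        (h t (f x) - f x - l * t) - (h t (f x) - f x - D s x * (h t x - x) - v x * t))
        by (unfold d; field; auto).
      assert (Hd : Rabs (D s x) * Rabs d <= B * Rabs t + e * Rabs t).
      { rewrite <- Rabs_mult, Ed. eapply Rle_trans. apply Rabs_triang.
        rewrite Rabs_Ropp. lra. }
      pose proof (Rabs_pos d) as Hd0.
      apply Rmult_le_reg_l with lam; [lra |].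
      replace (lam * ((B / lam + e) * Rabs t))
        with (B * Rabs t + lam * (e * Rabs t)) by (field; lra).
      assert (lam * Rabs d <= Rabs (D s x) * Rabs d) by (apply Rmult_le_compat_r; lra).
      assert (0 <= e * Rabs t) by (apply Rmult_le_pos; lra).
      assert (1 * (e * Rabs t) <= lam * (e * Rabs t)) by (apply Rmult_le_compat_r; lra).
      lra. }
  intros x Ix.
  (* Approximate slopes with arbitrarily small [B] make the difference quotients Cauchy, so
     completeness supplies the derivative. *)
  destruct (proj1 (filterlim_locally_cauchy (U := R_CompleteSpace)
    (F := locally' 0) (FF := Rbar_locally'_filter 0)
    (fun t => (h t x - x) / t))) as [l Hl].
  - intros e. destruct (Hsmall (e / 2)) as [B [HB H]].
    { pose proof (cond_pos e). lra. }
    destruct (H x Ix) as [l Hl].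
    exists (fun t => Rabs ((h t x - x) / t - l) <= B). split.
    + unfold locally', within. revert Hl. apply filter_imp. intros t H1 Ht.
      apply Rmult_le_reg_r with (Rabs t). apply Rabs_pos_lt; auto.
      rewrite <- Rabs_mult.
      replace (((h t x - x) / t - l) * t) with (h t x - x - l * t) by (field; auto).
      exact H1.
    + intros s t Hs Ht.
      change (Rabs ((h t x - x) / t - (h s x - x) / s) < e).
      replace ((h t x - x) / t - (h s x - x) / s)
        with (((h t x - x) / t - l) + - ((h s x - x) / s - l)) by ring.
      eapply Rle_lt_trans. apply Rabs_triang. rewrite Rabs_Ropp. lra.
  - exists l. apply is_derive_littleo. intros e He. rewrite E0 by auto.
    pose proof (proj1 (filterlim_locally _ _) Hl (mkposreal e He)) as H.
    unfold locally', within in H. revert H. apply filter_imp. intros t H.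
    rewrite Rminus_0_r. destruct (Req_dec t 0) as [-> | Ht].
    + rewrite E0 by auto. rewrite Rminus_eq_0, Rmult_0_r, Rminus_0_r, Rabs_R0. lra.
    + specialize (H Ht). change (Rabs ((h t x - x) / t - l) < e) in H.
      replace (h t x - x - l * t) with (((h t x - x) / t - l) * t) by (field; auto).
      rewrite Rabs_mult. apply Rmult_le_compat_r; auto using Rabs_pos. lra.
Qed.

(** * The twisted cohomological equation; boundedness and continuity of its solution *)

(** The linearized estimate says that [h t (f x) - D s x * h t x] has derivative [v x] at [t = 0].
    At a point of both branches this holds with either slope. *)
Lemma conjugacy_derive_eq (s : bool) (x : R) :
  J s x ->
  v x = Derive (fun t => h t (f x)) 0 - D s x * Derive (fun t => h t x) 0.
Proof.
  intros Hx. pose proof (branch_subset s x Hx) as Ix.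
  pose proof (conj_maps _ _ _ _ _ _ _ _ _ HC x Ix) as If.
  pose proof conjugacy_at_zero as E0.
  assert (H1 : is_derive (fun t => h t (f x) - D s x * h t x) 0 (v x)).
  { apply is_derive_littleo. intros e He.
    generalize (conjugacy_linearized s x e Hx He). apply filter_imp. intros t H.
    rewrite !E0, !Rminus_0_r by auto.
    replace (h t (f x) - D s x * h t x - (f x - D s x * x) - v x * t)
      with (h t (f x) - f x - D s x * (h t x - x) - v x * t) by ring.
    exact H. }
  apply is_derive_unique in H1. rewrite <- H1.
  rewrite Derive_minus.
  - rewrite Derive_scal. reflexivity.
  - apply conjugacy_ex_derive, If.
  - apply ex_derive_scal, conjugacy_ex_derive, Ix.
Qed.

(** The difference quotients are bounded by the constant [C] of [conjugacy_near_id], uniformly in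
    [x], and the bound passes to the limit. *)
Lemma conjugacy_derive_bounded :
  exists M, 0 <= M /\ forall x, I x -> Rabs (Derive (fun t => h t x) 0) <= M.
Proof.
  destruct conjugacy_near_id as [C [HC0 Hnear]].
  exists C. split; auto. intros x Ix.
  pose proof (conjugacy_at_zero x Ix) as E0.
  apply le_epsilon. intros e He.
  set (l := Derive (fun t => h t x) 0).
  pose proof (proj1 (is_derive_littleo _ _ _)
    (Derive_correct _ _ (conjugacy_ex_derive x Ix)) e He) as H.
  destruct (filter_and _ _ H Hnear) as [d Hd].
  assert (Hd2 : 0 < d / 2) by (pose proof (cond_pos d); lra).
  destruct (Hd (d / 2)) as [H1 H2].
  { change (Rabs (d / 2 - 0) < d). rewrite Rminus_0_r, Rabs_pos_eq; lra. }
  specialize (H2 x Ix). change (Derive _ 0) with l in H1. rewrite E0, Rminus_0_r in H1.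
  apply Rmult_le_reg_r with (Rabs (d / 2)). { apply Rabs_pos_lt; lra. }
  rewrite <- Rabs_mult.
  replace (l * (d / 2)) with ((h (d / 2) x - x) + - (h (d / 2) x - x - l * (d / 2))) by ring.
  eapply Rle_trans. apply Rabs_triang. rewrite Rabs_Ropp. lra.
Qed.

Lemma conjugacy_derive_continuous :
  continuous_on I (fun x => Derive (fun t => h t x) 0).
Proof.
  destruct conjugacy_derive_bounded as [M [HM0 HM]].
  pose proof conjugacy_derive_eq as Htce. pose proof branch_subset as Hsub.
  set (alpha := fun x => Derive (fun t => h t x) 0).
  change (forall x, I x -> Rabs (alpha x) <= M) in HM.
  change (forall s x, J s x -> v x = alpha (f x) - D s x * alpha x) in Htce.
  pose proof locally_cover as Hcover.
  destruct HC as [Hlam HK Hbr Hcov _ _ Hmaps Hcont _].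
  (* The contracted quantity is a bound on the oscillation of [alpha] at every point, initially
     [2 * M]. *)
  assert (Hsmall : forall e, 0 < e -> exists B, 0 <= B < e /\
    forall x, I x -> locally x (fun y => I y -> Rabs (alpha y - alpha x) <= B)).
  { apply contraction_small with (lam := lam) (B0 := 2 * M); auto; [lra | |].
    - intros x Ix. apply filter_forall. intros y Iy.
      pose proof (HM x Ix). pose proof (HM y Iy).
      eapply Rle_trans. apply Rabs_triang. rewrite Rabs_Ropp. lra.
    - intros B e HB He IH x Ix. apply Hcover. intros s Hx.
      destruct (Hbr s) as [HD HDc _ _ _ _ _ Hvc].
      assert (HaM : 0 < Rabs (alpha x) + 1) by (pose proof (Rabs_pos (alpha x)); lra).
      assert (He1 : 0 < e / 2 / (Rabs (alpha x) + 1))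
        by (repeat apply Rdiv_lt_0_compat; lra).
      assert (He2 : 0 < e / 2) by lra.
      (* The oscillation bound near [f x] is pulled back to a neighbourhood of [x] by continuity of
         [f]. *)
      pose proof (Hcont x Ix _ (IH (f x) (Hmaps x Ix))) as HBf.
      unfold filtermap, within in HBf.
      generalize (filter_and _ _ HBf
        (filter_and _ _ (proj1 (continuous_on_eps _ _) HDc x Hx _ He1)
          (proj1 (continuous_on_eps _ _) Hvc x Hx _ He2))).
      apply filter_imp. intros y [Hf [HDy Hvy]] Hy.
      pose proof (Hsub s y Hy) as Iy.
      specialize (Hf Iy (Hmaps y Iy)). specialize (HDy Hy). specialize (Hvy Hy).
      (* Difference of the equations at [y] and [x]: besides the oscillation at [f x], only the
         variations of [v] and [D s] remain, both small along one branch. *)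
      assert (E : D s y * (alpha y - alpha x) =
        (alpha (f y) - alpha (f x)) + (- (v y - v x) + - ((D s y - D s x) * alpha x))).
      { rewrite (Htce s x Hx), (Htce s y Hy). ring. }
      assert (H1 : Rabs ((D s y - D s x) * alpha x) <= e / 2).
      { rewrite Rabs_mult.
        apply Rle_trans with (e / 2 / (Rabs (alpha x) + 1) * (Rabs (alpha x) + 1)).
        - apply Rmult_le_compat; try apply Rabs_pos; lra.
        - right. field. lra. }
      assert (H2 : Rabs (D s y) * Rabs (alpha y - alpha x) <= B + e).
      { rewrite <- Rabs_mult, E. eapply Rle_trans. apply Rabs_triang.
        pose proof (Rabs_triang (- (v y - v x)) (- ((D s y - D s x) * alpha x))) as H3.
        rewrite !Rabs_Ropp in H3. lra. }
      specialize (HD y Hy). pose proof (Rabs_pos (alpha y - alpha x)) as H3.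
      apply Rmult_le_reg_l with lam; [lra |].
      replace (lam * (B / lam + e)) with (B + lam * e) by (field; lra).
      assert (lam * Rabs (alpha y - alpha x) <= Rabs (D s y) * Rabs (alpha y - alpha x))
        by (apply Rmult_le_compat_r; lra).
      assert (1 * e <= lam * e) by (apply Rmult_le_compat_r; lra).
      lra. }
  apply continuous_on_eps. intros x Ix e He.
  destruct (Hsmall e He) as [B [HB H]]. generalize (H x Ix).
  apply filter_imp. intros y Hy Iy.
  apply Rle_lt_trans with (1 := Hy Iy). lra.
Qed.

Lemma speed_continuous : continuous_on I v.
Proof.
  apply continuous_on_eps. intros x Ix e He. apply locally_cover. intros s Hx.
  apply (proj1 (continuous_on_eps _ _)
    (branch_speed_cont _ _ _ _ _ _ _ (conj_branch _ _ _ _ _ _ _ _ _ HC s)) x Hx e He).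
Qed.

End BranchedConjugacy.

(** * Derivatives relative to [I] and horizontality along the critical orbit *)

(** Near [x] the set [I] lies in [J], so the quotients within [I] tend to the branch slope [d]. As
    [x] is an accumulation point of [I], this limit is unique, which determines the [iota] in
    [derive_on]. *)
Lemma derive_on_branch (I J : R -> Prop) (f : R -> R) (x d : R) :
  (forall e, 0 < e ->
    locally x (fun y => J y -> Rabs (f y - f x - d * (y - x)) <= e * Rabs (y - x))) ->
  locally x (fun y => I y -> J y) ->
  (forall P : R -> Prop, locally x P -> exists y, I y /\ y <> x /\ P y) ->
  derive_on I f x = d.
Proof.
  intros Hd HIJ Hacc.
  assert (Hq : forall e, 0 < e ->
    locally x (fun y => y <> x -> I y -> Rabs ((f y - f x) / (y - x) - d) <= e)).
  { intros e He. generalize (filter_and _ _ (Hd e He) HIJ). apply filter_imp.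
    intros y [H1 H2] Hy Iy. specialize (H1 (H2 Iy)).
    assert (Hyx : y - x <> 0) by lra.
    apply Rmult_le_reg_r with (Rabs (y - x)). { apply Rabs_pos_lt; auto. }
    rewrite <- Rabs_mult.
    replace (((f y - f x) / (y - x) - d) * (y - x))
      with (f y - f x - d * (y - x)) by (field; auto).
    exact H1. }
  unfold derive_on. apply (iota_unique (V := R_CompleteNormedModule)).
  - intros d' Hd'. apply cond_eq. intros e He.
    assert (He2 : 0 < e / 2) by lra.
    pose proof (proj1 (filterlim_locally _ _) Hd' (mkposreal _ He2)) as H.
    unfold within, locally' in H. unfold within in H.
    destruct (Hacc _ (filter_and _ _ H (Hq _ He2))) as [y [Iy [Hy [H1 H2]]]].
    specialize (H1 Hy Iy). specialize (H2 Hy Iy).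
    change (Rabs ((f y - f x) / (y - x) - d') < e / 2) in H1.
    replace (d' - d)
      with (((f y - f x) / (y - x) - d) + - ((f y - f x) / (y - x) - d')) by ring.
    eapply Rle_lt_trans. apply Rabs_triang. rewrite Rabs_Ropp. lra.
  - apply filterlim_locally. intros e. unfold within, locally'. unfold within.
    assert (He2 : 0 < e / 2) by (pose proof (cond_pos e); lra).
    generalize (Hq _ He2). apply filter_imp. intros y H Hy Iy.
    change (Rabs ((f y - f x) / (y - x) - d) < e). specialize (H Hy Iy).
    pose proof (cond_pos e). lra.
Qed.

Lemma Icc_accumulation (a b x : R) (P : R -> Prop) :
  a < b -> Icc a b x -> locally x P -> exists y, Icc a b y /\ y <> x /\ P y.
Proof.
  unfold Icc. intros Hab Hx [d Hd]. pose proof (cond_pos d).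
  destruct (Rlt_dec x b) as [Hb | Hb].
  - exists (Rmin b (x + d / 2)).
    assert (Hy : x < Rmin b (x + d / 2) <= x + d / 2 /\ Rmin b (x + d / 2) <= b).
    { unfold Rmin. destruct Rle_dec; lra. }
    repeat split; try lra. apply Hd.
    change (Rabs (Rmin b (x + d / 2) - x) < d). rewrite Rabs_pos_eq; lra.
  - exists (Rmax a (x - d / 2)).
    assert (Hy : x - d / 2 <= Rmax a (x - d / 2) < x /\ a <= Rmax a (x - d / 2)).
    { unfold Rmax. destruct Rle_dec; lra. }
    repeat split; try lra. apply Hd.
    change (Rabs (Rmax a (x - d / 2) - x) < d).
    rewrite Rabs_minus_sym, Rabs_pos_eq; lra.
Qed.

(* By the twisted cohomological equation the sum telescopes. *)
Lemma horizontal_partial_sum (a c b lam : R) (f v alpha : R -> R) :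
  0 < lam -> Icc a b c -> (forall x, Icc a b x -> Icc a b (f x)) ->
  (forall x, Icc a b x -> x <> c -> lam <= Rabs (derive_on (Icc a b) f x)) ->
  (forall x, Icc a b x -> x <> c ->
    v x = alpha (f x) - derive_on (Icc a b) f x * alpha x) ->
  v c = alpha (f c) ->
  forall n, (forall i, (0 < i <= n)%nat -> orbit f c i <> c) ->
  lam ^ n <= Rabs (orbit_deriv a c b f n) /\
  sum_n (fun j => v (orbit f c j) / orbit_deriv a c b f j) n =
    alpha (orbit f c (S n)) / orbit_deriv a c b f n.
Proof.
  intros Hlam Ic Hf Hexp Htce Hvc.
  assert (Io : forall i, Icc a b (orbit f c i)).
  { induction i as [| i IH]; [exact Ic | apply Hf, IH]. }
  induction n as [| n IH]; intros Hn.
  - rewrite sum_O. simpl. rewrite Rabs_R1. split; [lra |]. rewrite Hvc. reflexivity.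
  - destruct IH as [H1 H2]. { intros i Hi. apply Hn. lia. }
    rewrite sum_Sn, H2. clear H2.
    assert (Hne : orbit f c (S n) <> c) by (apply Hn; lia).
    pose proof (Hexp _ (Io (S n)) Hne) as H3.
    pose proof (Htce _ (Io (S n)) Hne) as H4.
    change (f (orbit f c (S n))) with (orbit f c (S (S n))) in H4.
    rewrite H4. cbn [orbit_deriv pow]. clear H4.
    set (x := orbit f c (S n)) in *. set (d := derive_on (Icc a b) f x) in *.
    set (E := orbit_deriv a c b f n) in *.
    pose proof (pow_lt lam n Hlam) as Hp. split.
    + rewrite Rabs_mult, (Rmult_comm lam). apply Rmult_le_compat; lra.
    (* The growth bound [lam ^ n] keeps the denominators nonzero. *)
    + assert (HE : E <> 0) by (intros HE; rewrite HE, Rabs_R0 in H1; lra).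
      assert (Hd : d <> 0) by (intros Hd; rewrite Hd, Rabs_R0 in H3; lra).
      change (alpha x / E + (alpha (orbit f c (S (S n))) - d * alpha x) / (E * d)
        = alpha (orbit f c (S (S n))) / (E * d)).
      field. auto.
Qed.

(** The partial sum through index [n] is [alpha] at [orbit f c (S n)] over [orbit_deriv a c b f n].
    For a periodic [c] the last numerator is [alpha c = 0]; otherwise the quotient is at most
    [M * (/ lam) ^ n]. *)
Lemma horizontal_intro (a c b lam M : R) (f v alpha : R -> R) :
  1 < lam -> Icc a b c -> (forall x, Icc a b x -> Icc a b (f x)) ->
  continuous_on (Icc a b) v ->
  (forall x, Icc a b x -> Rabs (alpha x) <= M) ->
  alpha c = 0 ->
  (forall x, Icc a b x -> x <> c -> lam <= Rabs (derive_on (Icc a b) f x)) ->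
  (forall x, Icc a b x -> x <> c ->
    v x = alpha (f x) - derive_on (Icc a b) f x * alpha x) ->
  v c = alpha (f c) ->
  horizontal a c b f v.
Proof.
  intros Hlam Ic Hf Hv HM Hac Hexp Htce Hvc.
  assert (Hlam0 : 0 < lam) by lra.
  pose proof (horizontal_partial_sum a c b lam f v alpha Hlam0 Ic Hf Hexp Htce Hvc) as Hsum.
  split; [exact Hv | split].
  - intros n [Hn [Hper Hmin]].
    destruct (Hsum (pred n)) as [_ ->].
    + intros i Hi. apply Hmin. lia.
    (* [sum_n] includes its upper index, so summing to [pred n] ends with [alpha] at the return
       [orbit f c n = c]. *)
    + replace (S (pred n)) with n by lia. rewrite Hper, Hac. apply Rmult_0_l.
  - intros Hne.
    assert (Io : forall i, Icc a b (orbit f c i)).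
    { induction i as [| i IH]; [exact Ic | apply Hf, IH]. }
    apply (is_lim_seq_abs_0 (sum_n (fun j => v (orbit f c j) / orbit_deriv a c b f j))).
    apply is_lim_seq_le_le with (u := fun _ => 0) (w := fun n => M * (/ lam) ^ n).
    + intros n. split; [apply Rabs_pos |].
      destruct (Hsum n) as [H1 ->]. { intros i Hi. apply Hne. lia. }
      pose proof (pow_lt lam n Hlam0) as Hp.
      unfold Rdiv. rewrite Rabs_mult, Rabs_inv, pow_inv.
      apply Rmult_le_compat; auto using Rabs_pos.
      * apply Rlt_le, Rinv_0_lt_compat. lra.
      * apply Rinv_le_contravar; auto.
    + apply is_lim_seq_const.
    + replace (Finite 0) with (Rbar_mult M 0) by (simpl; rewrite Rmult_0_r; reflexivity).
      apply is_lim_seq_scal_l. apply is_lim_seq_geom.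
      assert (0 < / lam) by (apply Rinv_0_lt_compat; lra).
      rewrite Rabs_pos_eq by lra. rewrite <- Rinv_1. apply Rinv_lt_contravar; lra.
Qed.

(** * Application to unimodal perturbations *)

Lemma closed_Icc (l u : R) : closed (Icc l u).
Proof. apply closed_and; [apply closed_ge | apply closed_le]. Qed.

Lemma perturbation_branched_conjugacy (r0 r : nat) (a c b eps : R)
    (f : R -> R) (ft h : R -> R -> R) :
  (2 <= r)%nat -> (1 <= r0)%nat -> a < c -> c < b ->
  unimodal r a c b f -> perturbation r0 r a c b eps f ft ->
  locally 0 (fun t => conjugates a c b (h t) f (ft t)) ->
  exists D lam K,
    branched_conjugacy (Icc a b) (fun s : bool => if s then Icc a c else Icc c b)
      f ft h (fun x => Derive (fun t => ft t x) 0) D lam K.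
Proof.
  intros Hr Hr0 hac hcb hf [Heps Huni H0 Hb1 Hb2 Hs1 Hs2] hh.
  destruct (branch_intro r r0 a c eps f ft) as (D1 & lam1 & K1 & Hl1 & HK1 & B1); auto.
  { intros x Hx. apply H0. unfold Icc in *. lra. }
  { apply hf. }
  destruct (branch_intro r r0 c b eps f ft) as (D2 & lam2 & K2 & Hl2 & HK2 & B2); auto.
  { intros x Hx. apply H0. unfold Icc in *. lra. }
  { apply hf. }
  (* The weaker expansion and the larger perturbation constant serve both branches. *)
  exists (fun s : bool => if s then D1 else D2), (Rmin lam1 lam2), (Rmax K1 K2).
  constructor.
  - apply Rmin_glb_lt; auto.
  - apply Rle_trans with (1 := HK1), Rmax_l.
  - intros [].
    + apply branch_weaken with (3 := B1); [apply Rmin_l | apply Rmax_l].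
    + apply branch_weaken with (3 := B2); [apply Rmin_r | apply Rmax_r].
  - intros x. unfold Icc. split.
    + intros Hx. destruct (Rle_dec x c); [exists true | exists false]; lra.
    + intros [[] Hx]; lra.
  - intros []; apply closed_Icc.
  - exists (b - a). split; [lra |]. unfold Icc. intros x y Hx Hy.
    apply Rabs_le. lra.
  - apply hf.
  - apply hf.
  - assert (Hu : locally 0 (fun t => unimodal r a c b (ft t))).
    { exists (mkposreal eps Heps). intros t Ht. apply Huni.
      change (Rabs (t - 0) < eps) in Ht. rewrite Rminus_0_r in Ht. exact Ht. }
    generalize (filter_and _ _ hh Hu). apply filter_imp. intros t [Hc Ht].
    destruct (conjugates_branches r a c b (h t) f (ft t)) as (E1 & E2 & E3); auto.
    split; [exact E1 | intros []; assumption].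
Qed.

Theorem corollary2p6 (r0 : nat) (a c b eps : R)
    (f : R -> R) (ft h : R -> R -> R)
    (hr0 : (2 <= r0)%nat) (hac : a < c) (hcb : c < b)
    (hf : unimodal r0 a c b f)
    (hft : perturbation r0 r0 a c b eps f ft)
    (hh : locally 0 (fun t => conjugates a c b (h t) f (ft t))) :
  let v := fun x => Derive (fun t => ft t x) 0 in
  let alpha := fun x => Derive (fun t => h t x) 0 in
  (forall x, Icc a b x -> ex_derive (fun t => h t x) 0) /\
  (exists M, forall x, Icc a b x -> Rabs (alpha x) <= M) /\
  (forall x, Icc a b x -> x <> c ->
     v x = alpha (f x) - derive_on (Icc a b) f x * alpha x) /\
  continuous_on (Icc a b) alpha /\
  alpha c = 0 /\
  v c - alpha (f c) = 0 /\
  horizontal a c b f v.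
Proof.
  intros v alpha.
  destruct (perturbation_branched_conjugacy r0 r0 a c b eps f ft h)
    as (D & lam & K & HC); auto; [lia |].
  set (J := fun s : bool => if s then Icc a c else Icc c b) in HC.
  assert (Htce : forall s x, J s x -> v x = alpha (f x) - D s x * alpha x)
    by exact (conjugacy_derive_eq _ _ _ _ _ _ _ _ _ HC).
  destruct (conjugacy_derive_bounded _ _ _ _ _ _ _ _ _ HC) as [M [_ HM]].
  assert (Ic : Icc a b c) by (unfold Icc; lra).
  (* For all small [t], [h t c] is the constant [c]. *)
  assert (Hac : alpha c = 0).
  { apply eq_trans with (2 := Derive_const c 0). apply Derive_ext_loc.
    revert hh. apply filter_imp. intros t (k & _ & E & _). exact E. }
  assert (Hvc : v c = alpha (f c)).
  { rewrite (Htce true c), Hac by (unfold J, Icc; lra). ring. }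
  (* Away from [c], a neighbourhood of [x] in [I] lies in one branch, so the derivative relative to
     [I] is that branch's slope. *)
  assert (Hside : forall x, Icc a b x -> x <> c ->
    exists s, J s x /\ derive_on (Icc a b) f x = D s x).
  { intros x Ix Hxc.
    assert (Hs : exists s, J s x /\ locally x (fun y => Icc a b y -> J s y)).
    { unfold J, Icc in *. destruct (Rlt_dec x c) as [Hlt | Hge].
      - exists true. split; [lra |]. generalize (open_lt c x Hlt).
        apply filter_imp. intros y Hy Iy. lra.
      - exists false. split; [lra |]. assert (Hgt : x > c) by lra.
        generalize (open_gt c x Hgt). apply filter_imp. intros y Hy Iy. lra. }
    destruct Hs as [s [Hx Hloc]]. exists s. split; auto.
    apply derive_on_branch with (J := J s); auto.
    - apply (branch_deriv _ _ _ _ _ _ _ (conj_branch _ _ _ _ _ _ _ _ _ HC s) x Hx).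
    - intros P HP. apply Icc_accumulation; auto; lra. }
  assert (Htce' : forall x, Icc a b x -> x <> c ->
    v x = alpha (f x) - derive_on (Icc a b) f x * alpha x).
  { intros x Ix Hxc. destruct (Hside x Ix Hxc) as [s [Hx ->]]. auto. }
  split; [exact (conjugacy_ex_derive _ _ _ _ _ _ _ _ _ HC) |].
  split; [exists M; exact HM |].
  split; [exact Htce' |].
  split; [exact (conjugacy_derive_continuous _ _ _ _ _ _ _ _ _ HC) |].
  split; [exact Hac |].
  split; [lra |].
  apply horizontal_intro with (lam := lam) (M := M) (alpha := alpha); auto.
  - apply (conj_lam _ _ _ _ _ _ _ _ _ HC).
  - apply hf.
  - exact (speed_continuous _ _ _ _ _ _ _ _ _ HC).
  - intros x Ix Hxc. destruct (Hside x Ix Hxc) as [s [Hx ->]].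
    apply (branch_slope _ _ _ _ _ _ _ (conj_branch _ _ _ _ _ _ _ _ _ HC s) x Hx).
Qed.
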